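(* Let $a,b,c>0$ and $\alpha,\beta\ge 0$ with $\alpha\neq\beta$. Assume that $$(X,Y)\sim\mathcal K_{\alpha}(a,b,c)\otimes\mathcal K_{\beta}(b,a,c),$$ and let $$U=Y\,\frac{1+\beta(X+Y)}{1+\alpha X+\beta Y}\quad\text{and}\quad V=X\,\frac{1+\alpha(X+Y)}{1+\alpha X+\beta Y}.$$ Then $$(U,V)\sim\mathcal K_{\alpha}(b,a,c)\otimes\mathcal K_{\beta}(a,b,c).$$
   Context: For $\alpha\ge 0$, $a,c>0$ and $b\in\mathbb R$, the scaled Kummer distribution $\mathcal K_\alpha(a,b,c)$ is the probability distribution on $\mathbb R$ with density (with respect to Lebesgue measure) proportional to $\frac{x^{a-1}e^{-cx}}{(1+\alpha x)^b}\,I_{(0,\infty)}(x)$. The notation $(X,Y)\sim\mu\otimes\nu$ means that the joint law of $(X,Y)$ is the product measure $\mu\otimes\nu$, i.e. $X$ and $Y$ are independent with $X\sim\mu$ and $Y\sim\nu$. *)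

(* Defs.v *)
From HB Require Import structures.
From mathcomp Require Import all_boot all_order all_algebra.
From mathcomp Require Import lra.
From mathcomp Require Import all_classical all_reals all_analysis.
From mathcomp Require Import measurable_realfun exponential_distribution.

Set Implicit Arguments.
Unset Strict Implicit.
Unset Printing Implicit Defensive.

Import Order.TTheory GRing.Theory Num.Theory.
Import numFieldNormedType.Exports.

Local Open Scope classical_set_scope.
Local Open Scope ring_scope.

Section kummer_pdf.
Context {R : realType}.
Local Notation mu := (@lebesgue_measure R).
Variables alpha a b c : R.

(* [powR] is only meaningful on positive arguments; the indicator discards the
   values at [x <= 0]. *)
Definition kummer_fun (x : R) : R :=
  x `^ (a - 1) * expR (- c * x) / (1 + alpha * x) `^ b * \1_(`]0, +oo[) x.

Definition kummer_pdf (x : R) : R :=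
  kummer_fun x / \int[mu]_y kummer_fun y.

(* A measure for all parameters; a probability measure when [0 <= alpha],
   [0 < a] and [0 < c], see [kummer_prob_setT]. *)
Definition kummer_prob (A : set R) : \bar R :=
  (\int[mu]_(x in A) (kummer_pdf x)%:E)%E.

Lemma kummer_fun_ge0 x : 0 <= kummer_fun x.
Proof. by rewrite !mulr_ge0 ?invr_ge0 ?powR_ge0 ?expR_ge0. Qed.

Lemma kummer_pdf_ge0 x : 0 <= kummer_pdf x.
Proof.
rewrite divr_ge0 ?kummer_fun_ge0// Rintegral_ge0// => y _.
exact: kummer_fun_ge0.
Qed.

Lemma measurable_kummer_fun : measurable_fun setT kummer_fun.
Proof.
rewrite /kummer_fun; under eq_fun do rewrite -powRN.
apply: measurable_funM; last exact: measurable_indic.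
apply: measurable_funM.
  apply: measurable_funM; first exact: measurable_powR.
  by apply: measurableT_comp => //; exact: measurable_funM.
apply: (measurableT_comp (measurable_powR _)).
by apply: measurable_funD => //; exact: measurable_funM.
Qed.

Lemma measurable_kummer_pdf : measurable_fun setT kummer_pdf.
Proof. by apply: measurable_funM => //; exact: measurable_kummer_fun. Qed.

Let kummer0 : kummer_prob set0 = 0%E.
Proof. by rewrite /kummer_prob integral_set0. Qed.

Let kummer_ge0 A : (0 <= kummer_prob A)%E.
Proof. by apply: integral_ge0 => x _; rewrite lee_fin kummer_pdf_ge0. Qed.

Let kummer_sigma_additive : semi_sigma_additive kummer_prob.
Proof.
move=> /= F mF tF mUF; rewrite /kummer_prob; apply: cvg_toP.
  apply: ereal_nondecreasing_is_cvgn => m n mn.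
  apply: lee_sum_nneg_natr => // k _ _; apply: integral_ge0 => /= x Fkx.
  by rewrite lee_fin kummer_pdf_ge0.
rewrite ge0_integral_bigcup//=.
- by apply/measurable_funTS/measurableT_comp => //; exact: measurable_kummer_pdf.
- by move=> x _; rewrite lee_fin kummer_pdf_ge0.
Qed.

HB.instance Definition _ := isMeasure.Build _ _ _
  kummer_prob kummer0 kummer_ge0 kummer_sigma_additive.

End kummer_pdf.

Section kummer_normalization.
Context {R : realType}.
Local Notation mu := (@lebesgue_measure R).
Variables alpha a b c : R.
Hypotheses (alpha_ge0 : 0 <= alpha) (a_gt0 : 0 < a) (c_gt0 : 0 < c).

Let measurable_powm1 (D : set R) : measurable_fun D (fun x : R => (x `^ (a - 1))%:E).
Proof. by apply/measurable_EFinP/measurable_funTS; exact: measurable_powR. Qed.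

Let integral_powm1 (e : R) : 0 < e < 1 ->
  (\int[mu]_(x in `[e, 1%R]) (x `^ (a - 1))%:E <= a^-1%:E)%E.
Proof.
move=> /andP[e0 e1].
have pos (x : R) : x \in `[e, 1%R]%R -> 0 < x.
  by rewrite in_itv/= => /andP[ex _]; exact: lt_le_trans ex.
have der (p x : R) : 0 < x -> derivable (@powR R ^~ p) x 1.
  by move=> x0; apply: derivable_powR; rewrite in_itv/= x0.
have cont (p x : R) : 0 < x -> {for x, continuous (@powR R ^~ p)}.
  by move=> x0; apply: differentiable_continuous; apply/derivable1_diffP; exact: der.
rewrite (@continuous_FTC2 _ _ (fun x => a^-1 * x `^ a))//.
- rewrite -EFinB lee_fin powR1 mulr1 lerBlDr lerDl.
  by rewrite mulr_ge0 ?powR_ge0// invr_ge0 ltW.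
- apply: continuous_in_subspaceT => x /set_mem xe.
  by apply: cont; exact: pos.
- split.
  + move=> x /subset_itv_oo_cc/pos x0; apply: derivableM => //; exact: der.
  + by apply: cvg_at_right_filter; apply: cvgM; [exact: cvg_cst|exact: cont].
  + by apply: cvg_at_left_filter; apply: cvgM; [exact: cvg_cst|exact: cont].
- move=> x /subset_itv_oo_cc/pos x0.
  rewrite derive1Ml; last exact: der.
  by rewrite powR_derive1 ?in_itv/= ?x0// mulKf// gt_eqF.
Qed.

Let integral_powm1_01 :
  (\int[mu]_(x in `]0%R, 1%R]) (x `^ (a - 1))%:E <= a^-1%:E)%E.
Proof.
pose F n : set R := [set` `[n.+2%:R^-1, 1]%R].
have FE : `]0, 1]%classic = \bigcup_n F n :> set R.
  apply/seteqP; split => x /=.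
    rewrite in_itv/= => /andP[x0 x1].
    have [n _ /(_ n (leqnn n)) xn] := near_infty_natSinv_lt (PosNum x0).
    exists n => //; rewrite /F/= in_itv/= x1 andbT.
    apply/ltW/(le_lt_trans _ xn); rewrite lef_pV2 ?posrE// ler_nat//.
  move=> [n _]; rewrite /F/= !in_itv/= => /andP[nx ->]; rewrite andbT.
  by apply: lt_le_trans nx; rewrite invr_gt0.
rewrite FE.
have cv : (\int[mu]_(x in F n) (x `^ (a - 1))%:E @[n --> \oo] -->
    \int[mu]_(x in \bigcup_n F n) (x `^ (a - 1))%:E)%E.
  apply: ge0_nondecreasing_set_cvg_integral.
  - apply/nondecreasing_seqP => n; rewrite subsetEset /F.
    apply: subset_itv; rewrite bnd_simp//.
    by rewrite lef_pV2 ?posrE// ler_nat.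
  - by move=> n; exact: measurable_itv.
  - by move=> n; exact: measurable_powm1.
  - by move=> n x _; rewrite lee_fin powR_ge0.
rewrite -(cvg_lim _ cv)//; apply: lime_le; first by apply/cvg_ex; eexists; exact: cv.
apply: nearW => n; apply: integral_powm1.
by rewrite invr_gt0 ltr0n/= invf_lt1// ltr1n.
Qed.

Let ln_le (d x : R) : 0 < d -> 0 < x -> ln x <= d * x - ln d.
Proof.
move=> d0 x0; rewrite lerBrDl -lnM ?posrE//.
by apply/ltW/ln_sublinear; rewrite mulr_gt0.
Qed.

Let kummer_fun_le : exists M1 M2 : R, [/\ 0 <= M1, 0 <= M2 & forall x,
  kummer_fun alpha a b c x <=
  M1 * (x `^ (a - 1) * \1_(`]0, 1]) x) + M2 * exponential_pdf (c / 2) x].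
Proof.
pose d := c / 2 / (`|a - 1| + `|b| * alpha + 1).
have den : 0 < `|a - 1| + `|b| * alpha + 1.
  by rewrite ltr_wpDl// addr_ge0// mulr_ge0.
have d0 : 0 < d by rewrite !divr_gt0.
have dE : (`|a - 1| + `|b| * alpha) * d <= c / 2.
  rewrite /d mulrCA ler_piMr ?divr_ge0 ?(ltW c_gt0)//.
  by rewrite ler_pdivrMr// mul1r lerDl.
pose K := `|a - 1| * - ln d + `|b| * (d - ln d).
pose M1 := (1 + alpha) `^ `|b|.
pose M2 := expR K / (c / 2).
have M1_ge0 : 0 <= M1 by exact: powR_ge0.
have M2_ge0 : 0 <= M2 by rewrite divr_ge0 ?expR_ge0// divr_ge0// ltW.
exists M1, M2; split => // x.
have pdf0 : 0 <= M2 * exponential_pdf (c / 2) x.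
  by rewrite mulr_ge0// exponential_pdf_ge0// divr_ge0// ltW.
rewrite /kummer_fun !indicE; have [x0|x0] := ltP 0 x; last first.
  rewrite memNset/= ?in_itv/= ?andbT; last by apply/negP; rewrite -leNgt.
  by rewrite mulr0 addr_ge0// !mulr_ge0 ?powR_ge0.
rewrite mem_set/= ?in_itv/= ?x0// mulr1 -powRN.
have y1 : 1 <= 1 + alpha * x by rewrite lerDl mulr_ge0// ltW.
have y0 : 0 < 1 + alpha * x by exact: lt_le_trans y1.
have bb : (1 + alpha * x) `^ (- b) <= (1 + alpha * x) `^ `|b|.
  by apply: ler_powR => //; rewrite -normrN ler_norm.
have [x1|x1] := leP x 1.
  rewrite mem_set/= ?in_itv/= ?x0// mulr1 -[leLHS]addr0 lerD//.
  rewrite -mulrA [leRHS]mulrC ler_wpM2l ?powR_ge0// -[leRHS]mul1r.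
  rewrite ler_pM ?expR_ge0 ?powR_ge0//.
    by rewrite -expR0 ler_expR mulNr oppr_le0 mulr_ge0// ltW.
  apply: (le_trans bb); rewrite /M1 ge0_ler_powR ?nnegrE// ?(ltW y0)//.
    by rewrite addr_ge0.
  by rewrite lerD2l ler_piMr.
rewrite -[leLHS]add0r lerD//; first by rewrite !mulr_ge0 ?powR_ge0.
rewrite exponential_pdfE; last exact: ltW.
rewrite mulrA divfK ?gt_eqF ?divr_gt0// -expRD.
have -> : x `^ (a - 1) = expR ((a - 1) * ln x) by rewrite /powR gt_eqF.
apply: (@le_trans _ _ (expR ((a - 1) * ln x) * expR (- c * x) *
    (1 + alpha * x) `^ `|b|)).
  by rewrite ler_wpM2l// mulr_ge0 ?expR_ge0.
rewrite [X in _ * X]/powR gt_eqF// -!expRD ler_expR.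
have h1 : (a - 1) * ln x <= `|a - 1| * (d * x - ln d).
  apply: (@le_trans _ _ (`|a - 1| * ln x)).
    by rewrite ler_wpM2r ?ler_norm// ln_ge0// ltW.
  by rewrite ler_wpM2l// ln_le.
have h2 : `|b| * ln (1 + alpha * x) <= `|b| * (d * (1 + alpha * x) - ln d).
  by rewrite ler_wpM2l// ln_le.
have h3 := ler_wpM2r (ltW x0) dE.
rewrite /K; nra.
Qed.

Lemma kummer_fun_integral_fin : (\int[mu]_x (kummer_fun alpha a b c x)%:E < +oo)%E.
Proof.
have [M1 [M2 [M10 M20 le_fun]]] := kummer_fun_le.
pose p x : R := x `^ (a - 1) * \1_(`]0, 1]) x.
have p0 x : 0 <= p x by rewrite mulr_ge0 ?powR_ge0.
have e0 x : 0 <= exponential_pdf (c / 2) x.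
  by rewrite exponential_pdf_ge0// divr_ge0// ltW.
have mp : measurable_fun setT p.
  by apply: measurable_funM; [exact: measurable_powR|exact: measurable_indic].
have me : measurable_fun setT (exponential_pdf (c / 2)).
  exact: measurable_exponential_pdf.
apply: (@le_lt_trans _ _
    (\int[mu]_x ((M1%:E * (p x)%:E) + M2%:E * (exponential_pdf (c / 2) x)%:E)))%E.
  apply: ge0_le_integral => //.
  - by move=> x _; rewrite lee_fin kummer_fun_ge0.
  - by apply/measurable_EFinP; exact: measurable_kummer_fun.
  - by apply: emeasurable_funD; apply/measurable_EFinP; exact: measurable_funM.
  - by move=> x _; rewrite -!EFinM -EFinD lee_fin le_fun.
rewrite ge0_integralD//; last 4 first.
- by move=> x _; rewrite -EFinM lee_fin mulr_ge0.
- by apply/measurable_EFinP; exact: measurable_funM.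
- by move=> x _; rewrite -EFinM lee_fin mulr_ge0.
- by apply/measurable_EFinP; exact: measurable_funM.
rewrite !ge0_integralZl//; last 4 first.
- exact/measurable_EFinP.
- by move=> x _; rewrite lee_fin.
- exact/measurable_EFinP.
- by move=> x _; rewrite lee_fin.
rewrite integral_exponential_pdf ?divr_gt0// mule1.
rewrite lte_add_pinfty ?ltry// lte_mul_pinfty// ?lee_fin//.
apply: le_lt_trans (ltry a^-1); apply: le_trans integral_powm1_01.
rewrite [leRHS]integral_mkcond le_eqVlt; apply/orP; left; apply/eqP.
apply: eq_integral => x _; rewrite /p indicE patchE.
by case: ifPn => _; rewrite ?mulr1// mulr0.
Qed.

Lemma kummer_fun_integral_gt0 : (0 < \int[mu]_x (kummer_fun alpha a b c x)%:E)%E.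
Proof.
rewrite lt_neqAle integral_ge0 ?andbT; last first.
  by move=> x _; rewrite lee_fin kummer_fun_ge0.
apply/negP => /eqP/esym I0.
have mk := measurable_kummer_fun alpha a b c.
have /(ae_eq_integral_abs mu measurableT)[+ _] :
    measurable_fun setT (EFin \o kummer_fun alpha a b c).
  exact/measurable_EFinP.
case.
  rewrite -[RHS]I0; apply: eq_integral => x _ /=.
  by rewrite ger0_norm// kummer_fun_ge0.
move=> B [mB B0 subB].
suff : (1 <= mu B)%E by rewrite B0 lee_fin ler10.
rewrite (_ : 1%E = mu `]0%R, 1%R]); last first.
  by rewrite lebesgue_measure_itv/= lte_fin ltr01 oppr0 adde0.
apply: le_measure; rewrite ?inE// => x; rewrite /= in_itv/= => /andP[x0 _].
apply: subB => /= /(_ I) /eqP; apply/negP; rewrite eqe /kummer_fun.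
rewrite indicE mem_set/= ?in_itv/= ?x0// mulr1 gt_eqF//.
by rewrite divr_gt0 ?mulr_gt0 ?expR_gt0 ?powR_gt0// ltr_pwDl// mulr_ge0// ltW.
Qed.

Lemma kummer_prob_setT : kummer_prob alpha a b c setT = 1%E.
Proof.
have Ifin : (\int[mu]_x (kummer_fun alpha a b c x)%:E)%E \is a fin_num.
  rewrite ge0_fin_numE ?kummer_fun_integral_fin// integral_ge0// => x _.
  by rewrite lee_fin kummer_fun_ge0.
rewrite /kummer_prob /kummer_pdf; under eq_integral do rewrite mulrC EFinM.
rewrite ge0_integralZl//; last 3 first.
- by apply/measurable_EFinP; exact: measurable_kummer_fun.
- by move=> x _; rewrite lee_fin kummer_fun_ge0.
- rewrite lee_fin invr_ge0 Rintegral_ge0// => x _; exact: kummer_fun_ge0.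
rewrite /Rintegral -{2}(fineK Ifin) -EFinM mulVf// fine_eq0//.
by rewrite gt_eqF// kummer_fun_integral_gt0.
Qed.

HB.instance Definition _ := @Measure_isProbability.Build _ _ R
  (kummer_prob alpha a b c) kummer_prob_setT.

End kummer_normalization.

(* [(X, Y) ~ m1 (x) m2].  Laws are compared on measurable sets only: off them
   both sides are meaningless set functions. *)
Definition joint_law_prod {d} {T : measurableType d} {R : realType}
    (P : probability T R) (X Y : T -> R) (m1 m2 : set R -> \bar R) : Prop :=
  [/\ measurable_fun setT X, measurable_fun setT Y &
      forall A : set (R * R), measurable A ->
        pushforward P (fun w => (X w, Y w)) A = (m1 \x m2)%E A].

(* Main.v *)
Require Import Defs.
From HB Require Import structures.
From mathcomp Require Import all_boot all_order all_algebra.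
From mathcomp Require Import ring lra.
From mathcomp Require Import all_classical all_reals all_analysis.
From mathcomp Require Import measurable_realfun.

(** The map sending [(x, y)] to [(u, v)] preserves the sum: [u + v = x + y].
    Once the value [s] of that sum is fixed, only the one-variable map
    [y |-> u = y (1 + beta s) / (1 + alpha (s - y) + beta y)] is left.  It is a
    Moebius map, increasing from [`]0, s[] onto itself, with derivative
    [(1 + alpha s) (1 + beta s) / D ^ 2] where [D = 1 + alpha x + beta y].  The
    factorizations
      [1 + alpha u = (1 + alpha s) (1 + beta y) / D] and
      [1 + beta v = (1 + beta s) (1 + alpha x) / D]
    show that the unnormalized density of [K_alpha(b,a,c) (x) K_beta(a,b,c)] at
    [(u, v)], times this derivative, is the unnormalized density of
    [K_alpha(a,b,c) (x) K_beta(b,a,c)] at [(x, y)]; this is [kummer_fun_swap].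

    The two-dimensional change of variables therefore reduces to shears and
    one-variable substitutions: by Tonelli and translation invariance
    ([integral_shear_fst], [integral_shear_snd]) a planar integral is an
    integral over [s] of integrals along the line [x + y = s], and on each line
    the substitution above applies, in the version
    [integration_by_substitution_set] that handles integration over the
    preimage of a Borel set.  This gives [integral_kummer_swap].  Both
    distributions have total mass one, so that their normalizing constants
    need not be computed: they agree as soon as the unnormalized densities have
    the same integral over the plane. *)

Import Order.TTheory GRing.Theory Num.Theory.
Import numFieldNormedType.Exports.
Local Open Scope ring_scope.
Local Open Scope classical_set_scope.

(** * Measures with a density *)

(** The library's [pushforward] is a measure only in presence of a proof that
    the function is measurable, which unification cannot supply. *)
Definition image_measure {d1 d2} {T1 : measurableType d1}
    {T2 : measurableType d2} {R : realType} (mu : {measure set T1 -> \bar R})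
    (X : T1 -> T2) (mX : measurable_fun [set: T1] X) :
    {measure set T2 -> \bar R} :=
  measure_function_pushforward__canonical__measure_function_Measure mu mX.

Section density_measure.
Context {d} {T : measurableType d} {R : realType}.
Variables (mu : {measure set T -> \bar R}) (f : T -> R).
Hypotheses (mf : measurable_fun [set: T] f) (f0 : forall x, 0 <= f x).

(** The two proofs are arguments so that the [isMeasure] instance below can be
    inferred from the term. *)
Definition density_measure of measurable_fun [set: T] f & (forall x, 0 <= f x) :=
  fun A : set T => (\int[mu]_(x in A) (f x)%:E)%E.

Local Notation nu := (density_measure mf f0).

Let density0 : nu set0 = 0%E.
Proof. exact: integral_set0. Qed.

Let density_ge0 A : (0 <= nu A)%E.
Proof. by apply: integral_ge0 => x _; rewrite lee_fin. Qed.

Let density_sigma_additive : semi_sigma_additive nu.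
Proof.
move=> F mF tF mUF; apply: cvg_toP.
  apply: ereal_nondecreasing_is_cvgn => m n mn.
  apply: lee_sum_nneg_natr => // k _ _; exact: density_ge0.
rewrite /density_measure ge0_integral_bigcup//.
- exact/measurable_funTS/measurable_EFinP.
- by move=> x _; rewrite lee_fin.
Qed.

HB.instance Definition _ :=
  isMeasure.Build _ _ _ nu density0 density_ge0 density_sigma_additive.

End density_measure.

Section product_density.
Context {d1 d2 e1 e2} {T1 : measurableType d1} {T2 : measurableType d2}
  {S1 : measurableType e1} {S2 : measurableType e2} {R : realType}.
Variables (mu1 : {sigma_finite_measure set T1 -> \bar R})
  (mu2 : {sigma_finite_measure set T2 -> \bar R}).
Variables (p : T1 -> R) (q : T2 -> R).
Hypotheses (mp : measurable_fun setT p) (p0 : forall x, 0 <= p x).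
Hypotheses (mq : measurable_fun setT q) (q0 : forall x, 0 <= q x).
Variables (X : T1 -> S1) (Y : T2 -> S2).
Hypotheses (mX : measurable_fun setT X) (mY : measurable_fun setT Y).
Variables (m1 : {sigma_finite_measure set S1 -> \bar R})
  (m2 : {sigma_finite_measure set S2 -> \bar R}).
Hypothesis m1p : forall A, measurable A ->
  m1 A = (\int[mu1]_(x in X @^-1` A) (p x)%:E)%E.
Hypothesis m2q : forall A, measurable A ->
  m2 A = (\int[mu2]_(x in Y @^-1` A) (q x)%:E)%E.

(** A sigma-finite measure on [S1 * S2] is determined by its values on
    rectangles, where the formula is Tonelli's theorem.  The maps [X] and [Y]
    allow the densities to live on other measurable spaces than the laws: the
    Lebesgue measure is carried by an alias of the reals whose measurable
    structure has another display. *)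
Lemma product_density A : measurable A ->
  (m1 \x m2)%E A = (\int[mu1 \x mu2]_(z in (fun z => (X z.1, Y z.2)) @^-1` A)
    (p z.1 * q z.2)%:E)%E.
Proof.
have mpq : measurable_fun setT (fun z : T1 * T2 => p z.1 * q z.2).
  by apply: measurable_funM; apply: measurableT_comp.
have pq0 (z : T1 * T2) : 0 <= p z.1 * q z.2 by rewrite mulr_ge0.
have mXY : measurable_fun setT (fun z : T1 * T2 => (X z.1, Y z.2)).
  by apply: measurable_fun_pair; apply: measurableT_comp.
pose m := image_measure (density_measure (mu1 \x mu2)%E _ mpq pq0) _ mXY.
move=> mA; rewrite (@product_measure_unique _ _ _ _ _ _ _ m)// => {mA}A B mA mB.
have mXA : measurable (X @^-1` A) by rewrite -[X in measurable X]setTI; exact: mX.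
have mYB : measurable (Y @^-1` B) by rewrite -[X in measurable X]setTI; exact: mY.
rewrite /= /pushforward /density_measure integral_mkcond fubini_tonelli1/=; last 2 first.
- apply/(measurable_restrictT _ (measurableX mXA mYB)).
  exact/measurable_funTS/measurable_EFinP.
- by move=> z; rewrite patchE; case: ifPn => // _; rewrite lee_fin.
rewrite m1p// m2q// [in RHS]integral_mkcond -ge0_integralZr//; last 3 first.
- apply/(measurable_restrictT _ mXA).
  exact/measurable_funTS/measurable_EFinP.
- by move=> x _; rewrite patchE; case: ifPn => // _; rewrite lee_fin.
- by apply: integral_ge0 => x _; rewrite lee_fin.
apply: eq_integral => x _; rewrite /fubini_F.
rewrite patchE; case: ifPn => [|/negP] xA.
  rewrite -ge0_integralZl//; last 3 first.
  - exact/measurable_funTS/measurable_EFinP.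
  - by move=> y _; rewrite lee_fin.
  - by rewrite lee_fin.
  rewrite [RHS]integral_mkcond; apply: eq_integral => y _.
  rewrite !patchE (_ : ((x, y) \in _) = (y \in Y @^-1` B)); first by case: ifPn.
  apply/idP/idP => /set_mem/= h; apply/mem_set; first by case: h.
  by split=> //; exact: set_mem xA.
rewrite mul0e; apply: integral0_eq => y _.
by rewrite patchE memNset//= => -[/mem_set/xA].
Qed.

End product_density.

(** * Substitution over the preimage of a Borel set *)

Lemma measure_unique_itvcy {R : realType}
    (m1 m2 : {measure set (measurableTypeR R) -> \bar R}) :
  (forall y : R, m1 `[y, +oo[%classic = m2 `[y, +oo[%classic) ->
  (forall y : R, m1 `[y, +oo[%classic < +oo)%E ->
  forall B, measurable B -> m1 B = m2 B.
Proof.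
move=> m12 m1oo B mB.
apply: (@measure_unique _ R (measurableTypeR R) (@RGenCInfty.G R)
  (fun n => `[- n%:R, +oo[%classic) _ _ _ _ m1 m2) => //.
- exact: RGenCInfty.measurableE.
- move=> _ _ [x ->] [y ->]; exists (Num.max x y).
  by apply/seteqP; split => z /=; rewrite !in_itv/= !andbT ge_max => /andP.
- by move=> n; exists (- n%:R).
- rewrite -subTset => x _; exists (Num.bound `|x|) => //=.
  rewrite in_itv/= andbT lerNl (le_trans _ (ltW (archi_boundP (normr_ge0 x))))//.
  by rewrite -normrN ler_norm.
- by move=> _ [y ->].
Qed.

Section substitution_on_sets.
Context {R : realType}.
Local Notation mu := (@lebesgue_measure R).
Variables (a b : R) (F f G : R -> R).
Hypothesis F_derive : forall x : R^o, x \in `]a, b[%R -> is_derive x 1 F (f x).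
Hypothesis f_continuous : {in `]a, b[%R, continuous f}.
Hypothesis f_gt0 : {in `]a, b[%R, forall x, 0 < f x}.
Hypothesis G_continuous : {in `]a, b[%R, forall x, {for F x, continuous G}}.
Hypothesis mF : measurable_fun [set: R] F.
Hypothesis mG : measurable_fun [set: R] G.
Hypothesis G_ge0 : forall y, 0 <= G y.

Let F_continuous : {in `]a, b[%R, continuous F}.
Proof.
by move=> x /F_derive dF; apply/differentiable_continuous/derivable1_diffP.
Qed.

Let derive1F : {in `]a, b[%R, F^`() =1 f}.
Proof. by move=> x /F_derive dF; rewrite derive1E derive_val. Qed.

Let derive1F_continuous : {in `]a, b[%R, continuous F^`()}.
Proof.
move=> x xab; rewrite /continuous_at derive1F//.
apply: cvg_trans; last exact: (f_continuous x xab).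
apply: near_eq_cvg; near=> z.
by apply/esym/derive1F; near: z; exact: near_in_itvoo.
Unshelve. all: end_near. Qed.

Let F_incr : {in `]a, b[%R &, {homo F : x y / x < y}}.
Proof.
apply: gtr0_derive1_lt_oo => x xab; last by apply: F_continuous; exact: set_mem xab.
  by case: (F_derive x xab).
by rewrite derive1F// f_gt0.
Qed.

Let F_nd : {in `]a, b[%R &, {mono F : x y / x <= y}}.
Proof. exact: le_mono_in. Qed.

Let sub_oo p q : p \in `]a, b[%R -> q \in `]a, b[%R -> {subset `[p, q]%R <= `]a, b[%R}.
Proof.
rewrite !in_itv/= => /andP[ap _] /andP[_ qb] x; rewrite !in_itv/= => /andP[px xq].
by rewrite (lt_le_trans ap)// (le_lt_trans xq).
Qed.

Let IVT_F p q y : p <= q -> p \in `]a, b[%R -> q \in `]a, b[%R ->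
  y \in `[F p, F q]%R -> exists2 x, x \in `[p, q]%R & F x = y.
Proof.
move=> pq pab qab; rewrite in_itv/= => Fy; apply: IVT => //.
  apply: continuous_in_subspaceT => x /set_mem/(sub_oo _ _ pab qab).
  exact: F_continuous.
by rewrite min_l ?max_r// F_nd.
Qed.

Let mGf : measurable_fun `]a, b[ (fun x => G (F x) * f x).
Proof.
apply: measurable_funM; last first.
  apply: open_continuous_measurable_fun; first exact: interval_open.
  by move=> x /set_mem; exact: f_continuous.
by apply: (measurableT_comp mG); exact: measurable_funTS.
Qed.

Let Gf_ge0 x : x \in `]a, b[%R -> 0 <= G (F x) * f x.
Proof. by move=> xab; rewrite mulr_ge0// ltW// f_gt0. Qed.

Let substitution_segment p q : p <= q -> p \in `]a, b[%R -> q \in `]a, b[%R ->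
  (\int[mu]_(y in `[F p, F q]) (G y)%:E = \int[mu]_(x in `[p, q]) (G (F x) * f x)%:E)%E.
Proof.
move=> pq pab qab; have pqab := sub_oo _ _ pab qab.
have pqab' x : x \in `]p, q[%R -> x \in `]a, b[%R.
  by move=> xpq; apply: pqab; exact: subset_itv_oo_cc.
rewrite integration_by_substitution_increasing; [|exact: pq|..].
- apply: eq_integral => x /set_mem/pqab xab.
  by rewrite /= -derive1F.
- by move=> x y xpq ypq; apply: F_incr; exact: pqab.
- by move=> x /pqab'; exact: derive1F_continuous.
- by apply/cvg_ex; eexists; apply: cvg_at_right_filter; exact: derive1F_continuous.
- by apply/cvg_ex; eexists; apply: cvg_at_left_filter; exact: derive1F_continuous.
- split.
  + by move=> x /pqab' /F_derive[].
  + by apply: cvg_at_right_filter; exact: F_continuous.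
  + by apply: cvg_at_left_filter; exact: F_continuous.
- apply: continuous_in_subspaceT => y /set_mem /(IVT_F _ _ _ pq pab qab)[x /pqab xab <-].
  exact: G_continuous.
Qed.

(* Both sides are finite measures in [B]; on a half-line [[y, +oo[] they are
   integrals over a pair of corresponding segments, by the intermediate value
   theorem. *)
Let substitution_segment_set p q (B : set R) : p <= q ->
  p \in `]a, b[%R -> q \in `]a, b[%R -> measurable B ->
  (\int[mu]_(x in `[p, q] `&` F @^-1` B) (G (F x) * f x)%:E =
   \int[mu]_(y in `[F p, F q] `&` B) (G y)%:E)%E.
Proof.
move=> pq pab qab mB; have pqab := sub_oo _ _ pab qab.
pose w := (fun x => G (F x) * f x) \_ `[p, q].
pose v := G \_ `[F p, F q].
have mw : measurable_fun setT w.
  apply/(measurable_restrictT _ (measurable_itv _)).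
  by apply: measurable_funS mGf => // x; exact: pqab.
have w0 x : 0 <= w x.
  by rewrite /w patchE; case: ifPn => // /set_mem/pqab; exact: Gf_ge0.
have mv : measurable_fun setT v.
  apply/(measurable_restrictT _ (measurable_itv _)).
  exact: measurable_funTS.
have v0 x : 0 <= v x by rewrite /v patchE; case: ifPn.
pose m1 := pushforward (density_measure mu w mw w0) F.
pose m2 := density_measure mu v mv v0.
have m1E A : m1 A = (\int[mu]_(x in `[p, q] `&` F @^-1` A) (G (F x) * f x)%:E)%E.
  rewrite /m1 /pushforward /density_measure integral_mkcondl.
  by apply: eq_integral => x _; rewrite /w !patchE; case: ifPn.
have m2E A : m2 A = (\int[mu]_(y in `[F p, F q] `&` A) (G y)%:E)%E.
  rewrite /m2 /density_measure integral_mkcondl.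
  by apply: eq_integral => x _; rewrite /v !patchE; case: ifPn.
pose m1' := image_measure (T2 := measurableTypeR R)
  (density_measure mu w mw w0) _ mF.
rewrite -m1E -m2E.
apply: (measure_unique_itvcy m1' m2) mB => [y|y].
- rewrite [LHS]m1E [RHS]m2E.
  have [yFp|Fpy] := leP y (F p).
    rewrite (_ : _ `&` _ = `[p, q]%classic); last first.
      apply/setIidl => x /= xpq; rewrite in_itv/= andbT.
      apply: (le_trans yFp); rewrite F_nd//; last exact: pqab.
      by move: xpq; rewrite in_itv/= => /andP[].
    rewrite (_ : _ `&` _ = `[F p, F q]%classic) ?substitution_segment//.
    apply/setIidl => x /=; rewrite !in_itv/= andbT => /andP[+ _].
    exact: le_trans.
  have [yFq|Fqy] := leP y (F q); last first.
    rewrite [X in integral _ X _](_ : _ = set0); last first.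
      rewrite -subset0 => x [/= xpq]; rewrite in_itv/= andbT => yFx.
      have := lt_le_trans Fqy yFx; apply/negP; rewrite -leNgt F_nd//; last exact: pqab.
      by move: xpq; rewrite in_itv/= => /andP[].
    rewrite [X in _ = integral _ X _](_ : _ = set0) ?integral_set0//.
    rewrite -subset0 => x [/=]; rewrite !in_itv/= andbT => /andP[_ xFq] yx.
    by have := lt_le_trans Fqy (le_trans yx xFq); rewrite ltxx.
  have [|r rpq Fr] := IVT_F p q y pq pab qab; first by rewrite in_itv/= yFq ltW.
  have rab := pqab _ rpq; move: (rpq); rewrite in_itv/= => /andP[pr rq].
  rewrite -Fr.
  rewrite (_ : _ `&` _ = `[r, q]%classic); last first.
    apply/seteqP; split => x /=.
      move=> [xpq]; rewrite in_itv/= andbT F_nd//; last exact: pqab.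
      by move=> rx; move: xpq; rewrite !in_itv/= rx => /andP[].
    rewrite !in_itv/= andbT => /andP[rx xq].
    have xpq : x \in `[p, q]%R by rewrite in_itv/= xq (le_trans pr).
    by split; [rewrite xq (le_trans pr)|rewrite F_nd//; exact: pqab].
  rewrite (_ : _ `&` _ = `[F r, F q]%classic) ?substitution_segment//.
  apply/seteqP; split => x /=; rewrite !in_itv/= andbT.
    by move=> [/andP[_ ->] ->].
  by move=> /andP[Frx ->]; rewrite Frx andbT (le_trans _ Frx)// F_nd.
- rewrite [X in (X < _)%E]m1E.
  apply: (@le_lt_trans _ _ (\int[mu]_(x in `[p, q]) (G (F x) * f x)%:E)%E).
    apply: ge0_subset_integral => //.
    + by apply: measurableI => //; rewrite -[X in measurable X]setTI; exact: mF.
    + apply/measurable_EFinP; apply: measurable_funS mGf => // x; exact: pqab.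
    + by move=> x /pqab/Gf_ge0; rewrite lee_fin.
  rewrite -substitution_segment//.
  have : mu.-integrable `[F p, F q] (EFin \o G).
    apply: continuous_compact_integrable; first exact: segment_compact.
    apply: continuous_in_subspaceT => z /set_mem.
    by move=> /(IVT_F _ _ _ pq pab qab)[x /pqab xab <-]; exact: G_continuous.
  move=> /integrableP[_]; apply: le_lt_trans; rewrite le_eqVlt.
  by apply/orP; left; apply/eqP/eq_integral => x _; rewrite /= ger0_norm.
Qed.

(** Neither [G] nor [f] has to be bounded or integrable near the ends of
    [`]a, b[], so the segments [[p, q]] inside it are treated first and then
    exhaust it.  The set [B] stands for the indicator of an arbitrary Borel set
    as a factor of the integrand, which continuity of [G] alone excludes. *)
Lemma integration_by_substitution_set (B : set R) : measurable B ->
  (\int[mu]_(x in `]a, b[ `&` F @^-1` B) (G (F x) * f x)%:E =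
   \int[mu]_(y in (F @` `]a, b[) `&` B) (G y)%:E)%E.
Proof.
move=> mB; have [ba|ab] := leP b a.
  by rewrite set_itv_ge ?bnd_simp -?leNgt// image_set0 !set0I !integral_set0.
(* [n.+3] keeps [p n < q n] already for [n = 0]. *)
pose e n : R := (b - a) / n.+3%:R.
have e_gt0 n : 0 < e n by rewrite divr_gt0// subr_gt0.
have e_half n : e n + e n < b - a.
  rewrite /e -mulrDl ltr_pdivrMr// -[ltLHS]mulr2n -[ltLHS]mulr_natr ltr_pM2l ?subr_gt0//.
  by rewrite ltr_nat.
have e_ni n m : (n <= m)%N -> e m <= e n.
  move=> nm; rewrite ler_wpM2l ?subr_ge0 ?(ltW ab)//.
  by rewrite lef_pV2 ?posrE// ler_nat !ltnS.
pose p n := a + e n; pose q n := b - e n.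
have pq n : p n <= q n by rewrite /p /q; have := e_half n; lra.
have pab n : p n \in `]a, b[%R.
  by rewrite in_itv/= /p; have := e_half n; have := e_gt0 n; lra.
have qab n : q n \in `]a, b[%R.
  by rewrite in_itv/= /q; have := e_half n; have := e_gt0 n; lra.
have pni n m : (n <= m)%N -> p m <= p n by move=> /e_ni; rewrite /p; lra.
have qnd n m : (n <= m)%N -> q n <= q m by move=> /e_ni; rewrite /q; lra.
have pqE : `]a, b[%classic = \bigcup_n `[p n, q n]%classic.
  apply/seteqP; split => x /=; last by move=> [n _]; exact: sub_oo.
  rewrite in_itv/= => /andP[ax xb].
  pose m := Num.min (x - a) (b - x).
  have m0 : 0 < m by rewrite /m lt_min !subr_gt0 ax xb.
  have em : \forall n \near \oo, e n <= m.
    near=> n; rewrite ler_pdivrMr// mulrC -ler_pdivrMr//.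
    rewrite (@le_trans _ _ n%:R)//; last by rewrite ler_nat !leqW.
    by near: n; exact: nbhs_infty_ger.
  have [n _ /(_ n (leqnn n))] := em.
  rewrite /= le_min => /andP[ea eb]; exists n => //=.
  by rewrite in_itv/= /p /q; move: ea eb; lra.
have FpqE : F @` `]a, b[ = \bigcup_n `[F (p n), F (q n)]%classic.
  rewrite pqE image_bigcup; apply: eq_bigcupr => n _.
  apply/seteqP; split => [_ [x /= xpq <-]|y /=].
    have xab := sub_oo _ _ (pab n) (qab n) _ xpq.
    by move: xpq; rewrite !in_itv/= !F_nd.
  by move=> /(IVT_F _ _ _ (pq n) (pab n) (qab n))[x xpq <-]; exists x.
have mFB : measurable (F @^-1` B) by rewrite -[X in measurable X]setTI; exact: mF.
have cvgl : (\int[mu]_(x in `[p n, q n] `&` F @^-1` B) (G (F x) * f x)%:E @[n --> \oo]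
    --> \int[mu]_(x in `]a, b[ `&` F @^-1` B) (G (F x) * f x)%:E)%E.
  rewrite pqE setI_bigcupl; apply: ge0_nondecreasing_set_cvg_integral.
  - move=> n m nm; rewrite subsetEset; apply: setSI.
    by apply: subset_itv; rewrite bnd_simp ?pni ?qnd.
  - by move=> n; exact: measurableI.
  - move=> n; apply/measurable_EFinP; apply: measurable_funS mGf => //.
    by move=> x [/(sub_oo _ _ (pab n) (qab n))].
  - by move=> n x [/(sub_oo _ _ (pab n) (qab n))/Gf_ge0]; rewrite lee_fin.
have cvgr : (\int[mu]_(y in `[F (p n), F (q n)] `&` B) (G y)%:E @[n --> \oo]
    --> \int[mu]_(y in (F @` `]a, b[) `&` B) (G y)%:E)%E.
  rewrite FpqE setI_bigcupl; apply: ge0_nondecreasing_set_cvg_integral.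
  - move=> n m nm; rewrite subsetEset; apply: setSI.
    by apply: subset_itv; rewrite bnd_simp F_nd// ?pni ?qnd.
  - by move=> n; exact: measurableI.
  - by move=> n; apply/measurable_EFinP; exact: measurable_funTS.
  - by move=> n x _; rewrite lee_fin.
apply: (cvg_unique _ cvgl); first exact: ereal_hausdorff.
apply: cvg_trans cvgr; apply: near_eq_cvg; apply: nearW => n /=.
by rewrite substitution_segment_set.
Unshelve. all: end_near. Qed.

End substitution_on_sets.

(** * Integrating along the lines of constant sum *)

Section shear.
Context {R : realType}.
Local Notation mu := (@lebesgue_measure R).
Local Open Scope ereal_scope.

Lemma lebesgue_measure_shift (c : R) (A : set R) : measurable A ->
  mu ((fun x => x + c)%R @^-1` A) = mu A.
Proof.
move=> mA; apply/esym.
have mc : measurable_fun setT (fun x : measurableTypeR R => (x + c)%R).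
  exact: measurable_funD.
pose m := image_measure (T2 := measurableTypeR R) mu _ mc.
suff mE : forall X, ocitv X -> mu X = m X.
  exact: (lebesgue_measure_unique mE mA).
move=> _ [[x y]] _ <- /=.
rewrite /pushforward (_ : _ @^-1` _ = `](x - c)%R, (y - c)%R]%classic); last first.
  by apply/seteqP; split=> z /=; rewrite !in_itv/= ltrBlDr lerBrDr.
rewrite !lebesgue_measure_itv/= !lte_fin ltrD2r -!EFinB.
by rewrite opprB addrA subrK.
Qed.

Lemma ge0_integral_shift (c : R) (h : R -> \bar R) :
  measurable_fun [set: R] h -> (forall x, 0 <= h x) ->
  \int[mu]_x h (x + c)%R = \int[mu]_x h x.
Proof.
move=> mh h0; rewrite -[LHS](@ge0_integral_pushforward _ _ _ (measurableTypeR R) R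
  (fun x : measurableTypeR R => (x + c)%R) _ mu setT h)//; last exact: measurable_funD.
apply: eq_measure_integral => [|mc A mA _]; first exact: measurable_funD.
exact: (lebesgue_measure_shift c A mA).
Qed.

Variable h : R * R -> \bar R.
Hypotheses (mh : measurable_fun [set: R * R] h) (h_ge0 : forall z, 0 <= h z).

(** The shear [(x, y) |-> (x + y, y)] acts on each horizontal line as a
    translation, so it preserves the planar Lebesgue measure. *)
Lemma integral_shear_fst :
  \int[mu \x mu]_z h z = \int[mu]_s \int[mu]_y h ((s - y)%R, y).
Proof.
pose k (z : R * R) := h ((z.1 - z.2)%R, z.2).
have mk : measurable_fun [set: R * R] k.
  apply: measurableT_comp => //; apply: measurable_fun_pair => //.
  exact: measurable_funB.
transitivity (\int[mu]_y \int[mu]_s k (s, y)).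
  rewrite fubini_tonelli2; [|exact: mh|exact: h_ge0]; apply: eq_integral => y _.
  rewrite /fubini_G -[LHS](ge0_integral_shift (- y)%R) => [//||//].
  exact: measurable_fun_pair1.
apply/esym; apply: (@fubini_tonelli _ _ _ _ R mu mu k mk) => z; exact: h_ge0.
Qed.

Lemma integral_shear_snd :
  \int[mu \x mu]_z h z = \int[mu]_s \int[mu]_x h (x, (s - x)%R).
Proof.
pose k (z : R * R) := h (z.2, (z.1 - z.2)%R).
have mk : measurable_fun [set: R * R] k.
  apply: measurableT_comp => //; apply: measurable_fun_pair => //.
  exact: measurable_funB.
transitivity (\int[mu]_x \int[mu]_s k (s, x)).
  rewrite fubini_tonelli1; [|exact: mh|exact: h_ge0]; apply: eq_integral => x _.
  rewrite /fubini_F -[LHS](ge0_integral_shift (- x)%R) => [//||//].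
  exact: measurable_fun_pair2.
apply/esym; apply: (@fubini_tonelli _ _ _ _ R mu mu k mk) => z; exact: h_ge0.
Qed.

End shear.

(** * Unnormalized Kummer densities *)

Section kummer_fun_theory.
Context {R : realType}.

(** Turns the identities between products of real powers into linear identities
    between logarithms. *)
Lemma kummer_fun_gt0E (e a b c x : R) : 0 <= e -> 0 < x ->
  kummer_fun e a b c x = expR ((a - 1) * ln x - c * x - b * ln (1 + e * x)).
Proof.
move=> e0 x0; have ex0 : 0 < 1 + e * x by rewrite ltr_pwDl// mulr_ge0// ltW.
rewrite /kummer_fun indicE mem_set/= ?in_itv/= ?x0// mulr1 /powR !gt_eqF//.
by rewrite -expRD -expRN -expRD mulNr.
Qed.

Lemma kummer_fun_eq0 (e a b c x : R) : x <= 0 -> kummer_fun e a b c x = 0.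
Proof.
move=> x0; rewrite /kummer_fun indicE memNset ?mulr0//=.
by rewrite in_itv/= andbT; apply/negP; rewrite -leNgt.
Qed.

Lemma continuous_kummer_fun (e p q r x : R) : 0 <= e -> 0 < x ->
  {for x, continuous (kummer_fun e p q r)}.
Proof.
move=> e0 x0.
have : expR ((p - 1) * ln t - r * t - q * ln (1 + e * t)) @[t --> x] -->
    expR ((p - 1) * ln x - r * x - q * ln (1 + e * x)).
  apply: continuous_cvg; first exact: continuous_expR.
  apply: cvgB; first apply: cvgB.
  - by apply: cvgM; [exact: cvg_cst|exact: continuous_ln].
  - by apply: cvgM; [exact: cvg_cst|exact: cvg_id].
  - apply: cvgM; first exact: cvg_cst.
    apply: continuous_cvg.
      by apply: continuous_ln; rewrite ltr_pwDl// mulr_ge0// ltW.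
    by apply: cvgD; [exact: cvg_cst|apply: cvgM; [exact: cvg_cst|exact: cvg_id]].
rewrite -kummer_fun_gt0E// => h; apply: cvg_trans h.
apply: near_eq_cvg; near=> t; rewrite kummer_fun_gt0E//.
by near: t; exact: lt_nbhsr.
Unshelve. all: end_near. Qed.

(** The second factor has the first two shape parameters exchanged, as in both
    product laws of the theorem. *)
Definition kummer_fun2 (e e' p q r : R) (z : R * R) : R :=
  kummer_fun e p q r z.1 * kummer_fun e' q p r z.2.

Lemma kummer_fun2_ge0 (e e' p q r : R) z : 0 <= kummer_fun2 e e' p q r z.
Proof. by rewrite mulr_ge0// kummer_fun_ge0. Qed.

Lemma measurable_kummer_fun2 (e e' p q r : R) :
  measurable_fun [set: R * R] (kummer_fun2 e e' p q r).
Proof.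
by apply: measurable_funM; apply: measurableT_comp => //; exact: measurable_kummer_fun.
Qed.

Lemma kummer_fun2_eq0 (e e' p q r x y : R) : ~~ ((0 < x) && (0 < y)) ->
  kummer_fun2 e e' p q r (x, y) = 0.
Proof.
by rewrite negb_and -!leNgt /kummer_fun2/= => /orP[] h0;
  rewrite (kummer_fun_eq0 _ _ _ _ _ h0) ?mul0r ?mulr0.
Qed.

End kummer_fun_theory.

(** * The map exchanging the parameters *)

Lemma measurable_invr {R : realType} : measurable_fun [set: R] (@GRing.inv R).
Proof.
(* The square makes the argument nonnegative, where [powR] at [-1] is the
   inverse; the formula also holds at [0]. *)
rewrite (_ : GRing.inv = fun x : R => x * (x ^+ 2) `^ (- 1)); last first.
  apply/funext => x; rewrite powR_inv1 ?sqr_ge0//.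
  have [->|x0] := eqVneq x 0; first by rewrite invr0 mul0r.
  by field.
apply: measurable_funM => //.
by apply: (measurableT_comp (measurable_powR _)); exact: measurable_funX.
Qed.

Section kummer_swap.
Context {R : realType}.
Variables alpha beta : R.
Hypotheses (alpha_ge0 : 0 <= alpha) (beta_ge0 : 0 <= beta).

Definition kummer_swap (z : R * R) : R * R :=
  (z.2 * ((1 + beta * (z.1 + z.2)) / (1 + alpha * z.1 + beta * z.2)),
   z.1 * ((1 + alpha * (z.1 + z.2)) / (1 + alpha * z.1 + beta * z.2))).

Lemma measurable_kummer_swap : measurable_fun [set: R * R] kummer_swap.
Proof.
have m1 : measurable_fun [set: R * R] (@fst R R) by [].
have m2 : measurable_fun [set: R * R] (@snd R R) by [].
have mD : measurable_fun [set: R * R] (fun z => (1 + alpha * z.1 + beta * z.2)^-1).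
  apply: (measurableT_comp measurable_invr).
  by do !(apply: measurable_funD || apply: measurable_funM) => //.
by apply: measurable_fun_pair;
  do !(apply: measurable_funD || apply: measurable_funM) => //.
Qed.

(** The logarithms of [1 + alpha s], [1 + beta s] and [D] occur on the left with
    total coefficient [0]: those coming from the powers of [u], [v],
    [1 + alpha u] and [1 + beta v] cancel against the last factor, which is the
    absolute value of the Jacobian determinant of [kummer_swap]. *)
Lemma kummer_fun_swap (a b c x y : R) : 0 < x -> 0 < y ->
  let z := kummer_swap (x, y) in
  kummer_fun alpha b a c z.1 * kummer_fun beta a b c z.2 *
    ((1 + alpha * (x + y)) * (1 + beta * (x + y)) / (1 + alpha * x + beta * y) ^+ 2) =
  kummer_fun alpha a b c x * kummer_fun beta b a c y.
Proof.
move=> x0 y0; rewrite /kummer_swap/=.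
set A := 1 + alpha * (x + y); set B := 1 + beta * (x + y).
set D := 1 + alpha * x + beta * y.
have pos (e t : R) : 0 <= e -> 0 < t -> 0 < 1 + e * t.
  by move=> e0 t0; rewrite ltr_pwDl// mulr_ge0// ltW.
have A0 : 0 < A by rewrite pos// addr_gt0.
have B0 : 0 < B by rewrite pos// addr_gt0.
have D0 : 0 < D by rewrite ltr_pwDl ?pos// mulr_ge0// ltW.
have ax0 := pos _ _ alpha_ge0 x0; have by0 := pos _ _ beta_ge0 y0.
have lnMV (p q r : R) : 0 < p -> 0 < q -> 0 < r -> ln (p * (q / r)) = ln p + ln q - ln r.
  by move=> p0 q0 r0; rewrite !lnM ?posrE ?invr_gt0 ?divr_gt0// lnV// addrA.
have uE : 1 + alpha * (y * (B / D)) = (1 + beta * y) * (A / D).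
  by rewrite /A /B /D; field; rewrite gt_eqF.
have vE : 1 + beta * (x * (A / D)) = (1 + alpha * x) * (B / D).
  by rewrite /A /B /D; field; rewrite gt_eqF.
have JE : A * B / D ^+ 2 = expR (ln A + ln B - ln D - ln D).
  by rewrite !expRD !expRN !lnK ?posrE//; field; rewrite gt_eqF.
rewrite !kummer_fun_gt0E// ?mulr_gt0 ?invr_gt0// uE vE !lnMV// JE -!expRD.
congr expR.
have -> : c * x = c * (y * (B / D) + x * (A / D)) - c * y.
  by rewrite /A /B /D; field; rewrite gt_eqF.
ring.
Qed.

End kummer_swap.

(** * The map on a line of constant sum *)

Section fiber.
Context {R : realType}.
Variables alpha beta s : R.
Hypotheses (alpha_ge0 : 0 <= alpha) (beta_ge0 : 0 <= beta).

Let D y : R := 1 + alpha * (s - y) + beta * y.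
Let D_gt0 y : y \in `]0, s[%R -> 0 < D y.
Proof.
rewrite in_itv/= /D => /andP[y0 ys].
by rewrite -addrA ltr_pwDl// addr_ge0// mulr_ge0// ?subr_ge0 ltW.
Qed.

Definition swap_fiber y : R := (kummer_swap alpha beta (s - y, y)).1.
Definition swap_fiber_derive y : R :=
  (1 + alpha * s) * (1 + beta * s) / (1 + alpha * (s - y) + beta * y) ^+ 2.

(** The second coordinate is [s] minus the first: the sum is preserved. *)
Lemma kummer_swap_fiber y : y \in `]0, s[%R ->
  kummer_swap alpha beta (s - y, y) = (swap_fiber y, s - swap_fiber y).
Proof.
move=> /D_gt0; rewrite /D => D0; rewrite /swap_fiber /kummer_swap/=; congr pair.
by field; rewrite gt_eqF.
Qed.

Lemma is_derive_swap_fiber (y : R^o) : y \in `]0, s[%R ->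
  is_derive y 1 swap_fiber (swap_fiber_derive y).
Proof.
move=> ys; have D0 := D_gt0 y ys.
rewrite (_ : swap_fiber = fun t : R => (1 + beta * s) * (t * (D t)^-1)); last first.
  by apply/funext => t; rewrite /swap_fiber /kummer_swap/= subrK mulrCA.
have dD : is_derive y 1 D (beta - alpha).
  rewrite /D.
  have : is_derive y 1 (fun t : R => 1 + alpha * (s - t) + beta * t)
      (0 + (alpha *: (0 - 1)) + beta *: 1).
    by apply: is_deriveD.
  by move=> dd; apply: is_derive_eq; rewrite /GRing.scale/=; ring.
have dV : is_derive y 1 (fun t => (D t)^-1) (- (D y) ^- 2 *: (beta - alpha)).
  by apply: is_deriveV; rewrite gt_eqF.
apply: is_derive_eq; rewrite /swap_fiber_derive /GRing.scale/= -/(D y).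
by move: D0; rewrite /D => D0; field; rewrite gt_eqF.
Qed.

Lemma continuous_swap_fiber_derive : {in `]0, s[%R, continuous swap_fiber_derive}.
Proof.
move=> y /D_gt0 D0; apply: cvgM; first exact: cvg_cst.
apply: cvgV; first by rewrite expf_neq0// gt_eqF.
rewrite expr2; under eq_fun do rewrite expr2.
have cD : D t @[t --> y] --> D y.
  apply: cvgD; last by apply: cvgM; [exact: cvg_cst|exact: cvg_id].
  apply: cvgD; first exact: cvg_cst.
  by apply: cvgM; [exact: cvg_cst|apply: cvgB; [exact: cvg_cst|exact: cvg_id]].
exact: cvgM.
Qed.

Lemma swap_fiber_derive_gt0 : {in `]0, s[%R, forall y, 0 < swap_fiber_derive y}.
Proof.
move=> y ys; have := D_gt0 y ys; move: ys; rewrite in_itv/= => /andP[y0 ys] D0.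
have s0 := lt_trans y0 ys.
by rewrite divr_gt0 ?exprn_gt0// mulr_gt0// ltr_pwDl// mulr_ge0// ltW.
Qed.

Lemma swap_fiber_itv : swap_fiber @` `]0, s[ = `]0, s[%classic.
Proof.
have A0 : 0 < s -> 0 < 1 + alpha * s by move=> s0; rewrite ltr_pwDl// mulr_ge0// ltW.
have B0 : 0 < s -> 0 < 1 + beta * s by move=> s0; rewrite ltr_pwDl// mulr_ge0// ltW.
apply/seteqP; split => [_ [y /= ys <-]|u /= us].
  have D0 := D_gt0 y ys; move: (ys); rewrite !in_itv/= => /andP[y0 ysl].
  have [a0 b0] := (A0 (lt_trans y0 ysl), B0 (lt_trans y0 ysl)).
  have := kummer_swap_fiber y ys; rewrite /kummer_swap/= subrK => -[<- vE].
  rewrite mulr_gt0 ?divr_gt0//= -subr_gt0.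
  rewrite (_ : s - _ = (s - y) * ((1 + alpha * s) / D y)); last first.
    by move: D0; rewrite /D => D0; field; rewrite gt_eqF.
  by rewrite mulr_gt0 ?divr_gt0 ?subr_gt0.
move: (us); rewrite in_itv/= => /andP[u0 ul].
have [a0 b0] := (A0 (lt_trans u0 ul), B0 (lt_trans u0 ul)).
pose E := 1 + beta * (s - u) + alpha * u.
have E0 : 0 < E by rewrite /E -addrA ltr_pwDl// addr_ge0// mulr_ge0// ?subr_ge0 ltW.
(* The inverse is the same map with [alpha] and [beta] exchanged. *)
exists (u * ((1 + alpha * s) / E)).
  rewrite in_itv/= mulr_gt0 ?divr_gt0//= -subr_gt0.
  rewrite (_ : s - _ = (s - u) * ((1 + beta * s) / E)); last first.
    by move: E0; rewrite /E => E0; field; rewrite gt_eqF.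
  by rewrite mulr_gt0 ?divr_gt0 ?subr_gt0.
rewrite /swap_fiber /kummer_swap/= subrK.
have -> : 1 + alpha * (s - u * ((1 + alpha * s) / E)) + beta * (u * ((1 + alpha * s) / E))
    = (1 + alpha * s) * (1 + beta * s) / E.
  by move: E0; rewrite /E => E0; field; rewrite gt_eqF.
by field; rewrite !gt_eqF.
Qed.

End fiber.

(** * Image of the product of Kummer laws *)

Section kummer_swap_law.
Context {R : realType}.
Local Notation mu := (@lebesgue_measure R).
Variables alpha beta a b c : R.
Hypotheses (alpha_ge0 : 0 <= alpha) (beta_ge0 : 0 <= beta).

(** For [s <= 0] both integrands vanish and [`]0, s[] is empty, so the
    substitution formula covers this case as well. *)
Lemma integral_kummer_swap_fiber (A : set (R * R)) (s : R) : measurable A ->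
  (\int[mu]_y ((EFin \o kummer_fun2 alpha beta a b c) \_ (kummer_swap alpha beta @^-1` A))
     ((s - y)%R, y) =
   \int[mu]_u ((EFin \o kummer_fun2 alpha beta b a c) \_ A) (u, (s - u)%R))%E.
Proof.
move=> mA.
have pair_itv y : y \in `]0, s[%R = (0 < s - y) && (0 < y).
  by rewrite in_itv/= subr_gt0 andbC.
pose F := swap_fiber alpha beta s.
pose f := swap_fiber_derive alpha beta s.
pose B : set R := [set u | A (u, s - u)].
pose G u := kummer_fun2 alpha beta b a c (u, s - u).
have mpair : measurable_fun [set: R] (fun u : R => (u, s - u)).
  by apply: measurable_fun_pair => //; exact: measurable_funB.
have mpair' : measurable_fun [set: R] (fun u : R => (s - u, u)).
  by apply: measurable_fun_pair => //; exact: measurable_funB.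
have mB : measurable B by rewrite -[B]setTI; exact: mpair.
have mG : measurable_fun setT G.
  by apply: measurableT_comp mpair; exact: measurable_kummer_fun2.
have mF : measurable_fun setT F.
  apply: (measurableT_comp (f := fst)) => //.
  by apply: measurableT_comp mpair'; exact: measurable_kummer_swap.
have cG : {in `]0, s[%R, forall y, {for F y, continuous G}}.
  move=> y ys; have : F y \in `]0, s[%R.
    have /seteqP[+ _] := swap_fiber_itv alpha beta s alpha_ge0 beta_ge0.
    by apply; exists y.
  rewrite pair_itv => /andP[v0 u0].
  apply: cvgM; first exact: (continuous_kummer_fun _ _ _ _ _ alpha_ge0 u0).
  apply: (@cvg_comp _ _ _ (fun u => s - u) (kummer_fun beta a b c)); last first.
    exact: (continuous_kummer_fun _ _ _ _ _ beta_ge0 v0).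
  by apply: cvgB; [exact: cvg_cst|exact: cvg_id].
have := integration_by_substitution_set 0 s F f G
  (is_derive_swap_fiber alpha beta s alpha_ge0 beta_ge0)
  (continuous_swap_fiber_derive alpha beta s alpha_ge0 beta_ge0)
  (swap_fiber_derive_gt0 alpha beta s alpha_ge0 beta_ge0) cG mF mG
  (fun u => kummer_fun2_ge0 _ _ _ _ _ _) B mB.
rewrite swap_fiber_itv// => subst_eq.
apply: (etrans _ (etrans subst_eq _)).
  rewrite [RHS]integral_mkcond.
  apply: eq_integral => y _; rewrite patchE/= [RHS]patchE in_setI.
  have [ys|ys] := boolP (y \in `]0, s[%R); last first.
    rewrite kummer_fun2_eq0 -?pair_itv// if_same.
    by case: ifPn => // /andP[/set_mem]; rewrite /= (negPf ys).
  rewrite (mem_set (A := `]0, s[%classic) ys)/=.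
  have -> : ((s - y, y) \in kummer_swap alpha beta @^-1` A) = (y \in F @^-1` B).
    by apply/idP/idP => /set_mem/= h; apply/mem_set => /=; move: h;
      rewrite kummer_swap_fiber.
  move: (ys); rewrite pair_itv => /andP[x0 y0].
  case: ifPn => // _; congr EFin.
  rewrite /kummer_fun2/= -(kummer_fun_swap alpha beta)// kummer_swap_fiber//=.
  by rewrite subrK.
rewrite [LHS]integral_mkcond; apply: eq_integral => u _.
rewrite patchE [RHS]patchE in_setI.
have -> : ((u, s - u) \in A) = (u \in B).
  by apply/idP/idP => /set_mem h; exact/mem_set.
have [us|us] := boolP (u \in `]0, s[%R); first by rewrite mem_set.
rewrite memNset//=; last exact/negP.
by rewrite kummer_fun2_eq0 ?if_same// andbC -pair_itv.
Qed.

Lemma integral_kummer_swap (A : set (R * R)) : measurable A ->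
  (\int[mu \x mu]_(z in kummer_swap alpha beta @^-1` A)
     (kummer_fun2 alpha beta a b c z)%:E =
   \int[mu \x mu]_(z in A) (kummer_fun2 alpha beta b a c z)%:E)%E.
Proof.
move=> mA.
have mH : measurable (kummer_swap alpha beta @^-1` A).
  by rewrite -[X in measurable X]setTI; exact: measurable_kummer_swap.
have mw p q (B : set (R * R)) : measurable B ->
    measurable_fun setT ((EFin \o kummer_fun2 alpha beta p q c) \_ B).
  move=> mB; apply/(measurable_restrictT _ mB)/measurable_funTS/measurable_EFinP.
  exact: measurable_kummer_fun2.
have w0 p q (B : set (R * R)) z :
    (0 <= ((EFin \o kummer_fun2 alpha beta p q c) \_ B) z)%E.
  by rewrite patchE; case: ifPn => // _; rewrite lee_fin kummer_fun2_ge0.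
rewrite integral_mkcond integral_shear_fst; [|exact: mw|exact: w0].
rewrite [RHS]integral_mkcond integral_shear_snd; [|exact: mw|exact: w0].
by apply: eq_integral => s _; exact: integral_kummer_swap_fiber.
Qed.

End kummer_swap_law.

Section kummer_product.
Context {R : realType}.
Local Notation mu := (@lebesgue_measure R).

(** Bundles [kummer_prob] with the sign conditions that make it a
    probability. *)
Definition kummer_probability (e p q r : R) (e0 : 0 <= e) (p0 : 0 < p)
    (r0 : 0 < r) : probability R R :=
  Defs_kummer_prob__canonical__probability_measure_Probability q e0 p0 r0.

(** [K] is the product of the two normalizing factors; the total mass determines
    it as the inverse of the integral over the plane. *)
Lemma kummer_product_density (e e' p q r : R) : 0 <= e -> 0 <= e' ->
  0 < p -> 0 < q -> 0 < r -> exists K : \bar R, forall A, measurable A ->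
  (kummer_prob e p q r \x kummer_prob e' q p r)%E A =
    (K * \int[mu \x mu]_(z in A) (kummer_fun2 e e' p q r z)%:E)%E.
Proof.
move=> e0 e'0 p0 q0 r0.
pose Z (t u v w : R) := (\int[mu]_y kummer_fun t u v w y)^-1.
have Z0 t u v w : 0 <= Z t u v w.
  by rewrite invr_ge0 Rintegral_ge0// => y _; exact: kummer_fun_ge0.
have pdfE t u v w x : kummer_pdf t u v w x = kummer_fun t u v w x * Z t u v w by [].
exists (Z e p q r * Z e' q p r)%:E => A mA.
pose idTR : measurableTypeR R -> R := idfun.
have midTR : measurable_fun [set: measurableTypeR R] idTR.
  by move=> _ B mB; rewrite setTI.
have m2 := measurable_kummer_fun2 e e' p q r.
rewrite (product_density mu mu (kummer_pdf e p q r) (kummer_pdf e' q p r)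
  (measurable_kummer_pdf _ _ _ _) (kummer_pdf_ge0 _ _ _ _)
  (measurable_kummer_pdf _ _ _ _) (kummer_pdf_ge0 _ _ _ _)
  idTR idTR midTR midTR
  (kummer_probability _ _ q _ e0 p0 r0) (kummer_probability _ _ p _ e'0 q0 r0))//.
rewrite (_ : _ @^-1` A = A); last by apply/seteqP; split => -[].
rewrite -ge0_integralZl//.
- apply: eq_integral => z _; rewrite -EFinM; congr EFin.
  rewrite !pdfE /kummer_fun2.
  (* Hides the normalizing integrals from the conversion test of [ring]. *)
  set u := Z _ _ _ _; set v := Z _ _ _ _.
  set s := kummer_fun _ _ _ _ _; set t := kummer_fun _ _ _ _ _.
  by ring.
- exact/measurable_funTS/measurable_EFinP.
- by move=> z _; rewrite lee_fin kummer_fun2_ge0.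
- by rewrite lee_fin mulr_ge0.
Qed.

Lemma kummer_product_setT (e e' p q r : R) : 0 <= e -> 0 <= e' ->
  0 < p -> 0 < q -> 0 < r ->
  (kummer_prob e p q r \x kummer_prob e' q p r)%E setT = 1%E.
Proof.
move=> e0 e'0 p0 q0 r0; rewrite -setXTT.
rewrite (@product_measure1E _ _ _ _ _
  (kummer_probability _ _ q _ e0 p0 r0) (kummer_probability _ _ p _ e'0 q0 r0))//.
by rewrite /= !kummer_prob_setT// mule1.
Qed.

End kummer_product.

Theorem theorem2p1 (R : realType) (d : measure_display) (T : measurableType d)
    (P : probability T R) (a b c alpha beta : R) (X Y : T -> R) :
  0 < a -> 0 < b -> 0 < c -> 0 <= alpha -> 0 <= beta -> alpha <> beta ->
  joint_law_prod P X Y (kummer_prob alpha a b c) (kummer_prob beta b a c) ->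
  let U := fun w =>
    Y w * ((1 + beta * (X w + Y w)) / (1 + alpha * X w + beta * Y w)) in
  let V := fun w =>
    X w * ((1 + alpha * (X w + Y w)) / (1 + alpha * X w + beta * Y w)) in
  joint_law_prod P U V (kummer_prob alpha b a c) (kummer_prob beta a b c).
Proof.
move=> a0 b0 c0 al0 be0 _ [mX mY lawXY] U V.
have mXY : measurable_fun [set: T] (fun w => (X w, Y w)) by exact: measurable_fun_pair.
have mUV : measurable_fun [set: T] (kummer_swap alpha beta \o (fun w => (X w, Y w))).
  by apply: measurableT_comp mXY; exact: measurable_kummer_swap.
split.
- by rewrite (_ : U = fst \o (kummer_swap alpha beta \o (fun w => (X w, Y w))))//;
    exact: measurableT_comp mUV.
- by rewrite (_ : V = snd \o (kummer_swap alpha beta \o (fun w => (X w, Y w))))//;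
    exact: measurableT_comp mUV.
move=> A mA.
have mHA : measurable (kummer_swap alpha beta @^-1` A).
  by rewrite -[X in measurable X]setTI; exact: measurable_kummer_swap.
have [K1 K1E] := kummer_product_density alpha beta a b c al0 be0 a0 b0 c0.
have [K2 K2E] := kummer_product_density alpha beta b a c al0 be0 b0 a0 c0.
have I1 := kummer_product_setT alpha beta a b c al0 be0 a0 b0 c0.
have I2 := kummer_product_setT alpha beta b a c al0 be0 b0 a0 c0.
rewrite K1E// in I1; rewrite K2E// in I2.
rewrite -(integral_kummer_swap alpha beta a b c al0 be0 setT)// preimage_setT in I2.
(* Both equal the inverse of the common integral over the plane. *)
have K12 : K1 = K2 by rewrite -[LHS]mule1 -I2 muleCA I1 mule1.
apply: (etrans (lawXY _ mHA)); apply: (etrans (K1E _ mHA)).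
apply: (etrans _ (esym (K2E _ mA))); rewrite K12.
by congr (_ * _)%E; exact: (integral_kummer_swap alpha beta a b c al0 be0 A mA).
Qed.
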